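(* Let $X$ and $Y$ be Hausdorff spaces and let $f:X\to Y$ be a continuous surjection that is sequence-covering and boundary-compact. If $X\in\Omega$, then $f$ is a 1-sequence-covering map.
   Context: $\Omega$ denotes the class of all topological spaces $X$ such that every compact subset $K\subset X$ is metrizable and has a countable neighborhood base in $X$ (a countable family of open sets containing $K$ such that every open set containing $K$ contains a member of the family). A map $f:X\to Y$ is *boundary-compact* if for each $y\in Y$ the topological boundary $\partial f^{-1}(y)$ is compact in $X$. $f$ is *sequence-covering* if whenever $\{y_n\}$ is a convergent sequence in $Y$ there is a convergent sequence $\{x_n\}$ in $X$ with $x_n\in f^{-1}(y_n)$ for each $n$. $f$ is *1-sequence-covering* if for each $y\in Y$ there is $x\in f^{-1}(y)$ such that whenever $\{y_n\}$ is a sequence converging to $y$ in $Y$ there is a sequence $\{x_n\}$ converging to $x$ in $X$ with $x_n\in f^{-1}(y_n)$ for each $n$. *)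

(* Defs.v *)
From mathcomp Require Import all_boot all_order all_algebra.
From mathcomp Require Import all_classical all_reals all_analysis.

Set Implicit Arguments.
Unset Strict Implicit.
Unset Printing Implicit Defensive.

Local Open Scope classical_set_scope.
Local Open Scope ring_scope.

Definition is_metric (R : realType) (T : Type) (d : T -> T -> R) : Prop :=
  [/\ forall x y, 0 <= d x y,
      forall x y, d x y = 0 <-> x = y,
      forall x y, d x y = d y x
    & forall x y z, d x z <= d x y + d y z].

Definition metrizable (R : realType) (T : topologicalType) : Prop :=
  exists2 d : T -> T -> R, is_metric d &
    forall x, nbhs x =
      filter_from [set e : R | 0 < e] (fun e => [set y | d x y < e]).

Definition has_countable_nbhs_base (X : topologicalType) (K : set X) : Prop :=
  exists B : set (set X),
    [/\ countable B,
        forall V, B V -> open V /\ K `<=` V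
      & forall U, open U -> K `<=` U -> exists2 V, B V & V `<=` U].

(* [set_type K] carries the topology induced by the inclusion into [X]. All
   complete ordered fields being isomorphic, the choice of [R] is immaterial. *)
Definition Omega (R : realType) (X : topologicalType) : Prop :=
  forall K : set X, compact K ->
    metrizable R (set_type K) /\ has_countable_nbhs_base K.

Definition boundary (X : topologicalType) (A : set X) : set X :=
  closure A `\` interior A.

Definition boundary_compact (X Y : topologicalType) (f : X -> Y) : Prop :=
  forall y : Y, compact (boundary (f @^-1` [set y])).

(* Convergence is spelled out as the existence of a limit because [lim] and
   [cvg] presuppose a point, whereas [X] and [Y] may be empty. *)
Definition convergent_seq (T : topologicalType) (u : nat -> T) : Prop :=
  exists l : T, u @ \oo --> l.

Definition sequence_covering (X Y : topologicalType) (f : X -> Y) : Prop :=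
  forall y_ : nat -> Y, convergent_seq y_ ->
    exists2 x_ : nat -> X, convergent_seq x_ &
      forall n, (f @^-1` [set y_ n]) (x_ n).

Definition one_sequence_covering (X Y : topologicalType) (f : X -> Y) : Prop :=
  forall y : Y, exists2 x : X, (f @^-1` [set y]) x &
    forall y_ : nat -> Y, y_ @ \oo --> y ->
      exists2 x_ : nat -> X, x_ @ \oo --> x &
        forall n, (f @^-1` [set y_ n]) (x_ n).

(* Main.v *)
(** Fix [y]. Call [x] in the fibre of [y] good if, for each neighbourhood [U] of
    [x], every sequence converging to [y] is eventually in [f @` U]. A good point
    with a countable neighbourhood base witnesses the conclusion. If no point of
    the fibre is good, each [x] has an open neighbourhood [U x] and a sequence
    [u x] converging to [y] that is not eventually in [f @` U x]. Finitely many
    [U x] cover the compact boundary of the fibre; interleave the corresponding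
    [u x] and lift the result to a convergent sequence. Its limit lies on the
    boundary, hence in some [U x], so [u x] is eventually in [f @` U x],
    a contradiction. *)
Require Import Defs.
From HB Require Import structures.
From mathcomp Require Import all_boot all_order all_algebra.
From mathcomp Require Import all_classical all_reals all_analysis.

Set Implicit Arguments.
Unset Strict Implicit.
Unset Printing Implicit Defensive.

Local Open Scope classical_set_scope.

Definition interleave (T : Type) (I : Type) (i0 : I) (s : seq I)
    (u : I -> nat -> T) (n : nat) : T :=
  u (nth i0 s (n %% size s)) (n %/ size s).

(** The finitely many sequences share a tail index [N]; from position [N * size s] on, the quotient
    by [size s] is at least [N]. *)
Lemma cvg_interleave (T : topologicalType) (I : eqType) (i0 : I) (s : seq I)
    (u : I -> nat -> T) (l : T) :
  (0 < size s)%N -> (forall i, i \in s -> u i @ \oo --> l) ->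
  interleave i0 s u @ \oo --> l.
Proof.
move=> s0 ul V Vl.
have [N _ NV] : \forall n \near \oo, forall i, i \in s -> V (u i n).
  elim: s ul {s0} => [|i s IH] ul; first exact: nearW.
  have [N2 _ N2V] := ul i (mem_head _ _) V Vl.
  have [|N1 _ N1V] := IH; first by move=> j js; apply: ul; rewrite inE js orbT.
  exists (maxn N1 N2) => // n /=; rewrite geq_max => /andP[n1 n2] j.
  by rewrite inE => /predU1P[->|/(N1V n n1)//]; exact: N2V.
exists (N * size s)%N => // n /= Nn; apply: NV; first by rewrite /= leq_divRL.
by rewrite mem_nth// ltn_mod.
Qed.

(** Term [n] of [u i] occurs at position [n * size s + index i s], which is at least [n]. *)
Lemma near_interleave (T : Type) (I : eqType) (i0 : I) (s : seq I)
    (u : I -> nat -> T) (A : set T) (i : I) :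
  i \in s -> (\forall n \near \oo, A (interleave i0 s u n)) ->
  \forall n \near \oo, A (u i n).
Proof.
move=> si [N _ NA]; exists N => // n /= Nn.
have s0 : (0 < size s)%N by case: s si {NA}.
have := NA (n * size s + index i s)%N.
rewrite /interleave /= modnMDl modn_small ?index_mem// nth_index//.
rewrite divnMDl// divn_small ?index_mem// addn0; apply.
by rewrite (leq_trans Nn)// (leq_trans (leq_pmulr _ s0))// leq_addr.
Qed.

Lemma countable_base_sequence (X : topologicalType) (x : X) :
  has_countable_nbhs_base [set x] ->
  exists W : nat -> set X,
    [/\ forall k, nbhs x (W k), forall j k, (j <= k)%N -> W k `<=` W j
      & forall U, nbhs x U -> exists k, W k `<=` U].
Proof.
move=> [B [cB Bopen Bbase]].
(* The base is nonempty, since [setT] contains a member; [g] enumerates it, and finite intersections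
   make it decreasing. *)
have [B0|[g]] := pfcard_geP cB.
  by have [|//|V] := Bbase setT; [exact: openT|rewrite B0].
exists (fun k => [set z | forall j, (j <= k)%N -> g j z]); split.
- have gx j : nbhs x (g j).
    have [oV xV] := Bopen _ (@funS _ _ _ _ g j I); apply: open_nbhs_nbhs; split=> //.
    exact: xV.
  elim=> [|k IH].
    by apply: filterS (gx 0) => z gz j; rewrite leqn0 => /eqP ->.
  apply: filterS (filterI IH (gx k.+1)) => z [Wz gz] j.
  by rewrite leq_eqVlt => /predU1P[->//|]; exact: Wz.
- by move=> j k jk z Wz i ij; apply: Wz; exact: leq_trans jk.
- move=> U; rewrite nbhsE => -[G [oG Gx] GU].
  have [|V BV VG] := Bbase G oG; first by move=> _ ->.
  have [k _ gk] := @surj _ _ _ _ g V BV.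
  by exists k => z Wz; apply/GU/VG; rewrite -gk; exact: Wz.
Qed.

(** Take [x_ n] over [y_ n] in the smallest [W k] with [k <= n] whose image contains [y_ n], or
    anywhere in the fibre if there is none. The bound [n] ensures that a smallest one exists. *)
Lemma lift_cvg_of_image_nbhs (X : topologicalType) (Y : Type) (f : X -> Y) (x : X)
    (y_ : nat -> Y) :
  has_countable_nbhs_base [set x] -> set_surj [set: X] [set: Y] f ->
  (forall U, nbhs x U -> \forall n \near \oo, (f @` U) (y_ n)) ->
  exists2 x_ : nat -> X, x_ @ \oo --> x & forall n, (f @^-1` [set y_ n]) (x_ n).
Proof.
move=> /countable_base_sequence[W [Wx Wdecr Wbase]] fsurj fU.
have best n m : exists z, f z = y_ n /\
    forall k, (k <= m)%N -> (f @` W k) (y_ n) -> W k z.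
  elim: m => [|m [z [fz Wz]]].
    have [[z Wz fz]|nW] := pselect ((f @` W 0) (y_ n)).
      by exists z; split=> // k; rewrite leqn0 => /eqP ->.
    have [z _ fz] := fsurj (y_ n) I.
    by exists z; split=> // k; rewrite leqn0 => /eqP ->.
  have [[t Wt ft]|nW] := pselect ((f @` W m.+1) (y_ n)).
    by exists t; split=> // k km _; exact: Wdecr km _ Wt.
  exists z; split=> // k; rewrite leq_eqVlt => /predU1P[->//|]; exact: Wz.
have [x_ x_P] := choice (fun n => best n n).
exists x_ => [U /Wbase[k WU]|n]; last by case: (x_P n).
have [N _ NW] := fU _ (Wx k).
exists (maxn N k) => // n /=; rewrite geq_max => /andP[Nn kn].
by apply/WU/(x_P n).2 => //; exact: NW.
Qed.

(** The limit lies in the fibre by uniqueness of limits in [Y]; were it interior, the fibre would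
    contain a tail of [x_]. *)
Lemma lift_limit_in_boundary (X Y : topologicalType) (f : X -> Y)
    (x_ : nat -> X) (l : X) (y : Y) :
  hausdorff_space Y -> continuous f -> x_ @ \oo --> l ->
  f \o x_ @ \oo --> y -> ~ (\forall n \near \oo, f (x_ n) = y) ->
  boundary (f @^-1` [set y]) l.
Proof.
move=> hY fc xl fxy nfx.
have fl : f l = y.
  have fxl : f \o x_ @ \oo --> f l by exact: cvg_comp xl (fc l).
  exact: (@cvg_unique _ hY (f \o x_ @ \oo) _ _ _ fxl fxy).
split; first exact: subset_closure.
by move=> /xl.
Qed.

(* [compact_cover] is only available for pointed spaces. *)
Lemma compact_cover_of_point (X : topologicalType) (x0 : X) (A : set X) :
  compact A -> cover_compact A.
Proof.
pose Xp : ptopologicalType :=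
  HB.pack (X : Type) (Topological.class X) (isPointed.Build X x0).
have -> : cover_compact A = @compact Xp A by rewrite compact_cover.
by [].
Qed.

Lemma exists_good_point (X Y : topologicalType) (f : X -> Y) (y : Y) :
  hausdorff_space Y -> continuous f -> set_surj [set: X] [set: Y] f ->
  sequence_covering f -> compact (boundary (f @^-1` [set y])) ->
  exists2 x, f x = y & forall (y_ : nat -> Y), y_ @ \oo --> y ->
    forall U, nbhs x U -> \forall n \near \oo, (f @` U) (y_ n).
Proof.
move=> hY fc fsurj fcov bdc; apply: contrapT => nogood.
(* With [f x = y] as a premise inside the existential, [choice] yields a total [p]; off the fibre
   any pair will do. *)
have bad x : exists p : set X * (nat -> Y), f x = y ->
    [/\ open p.1, p.1 x, p.2 @ \oo --> y
      & ~ \forall n \near \oo, (f @` p.1) (p.2 n)].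
  apply: contrapT => nbad; apply: nogood; exists x.
    by apply: contrapT => fx; apply: nbad; exists (setT, fun=> y).
  move=> u uy U; rewrite nbhsE => -[G [oG Gx] GU].
  have [|nG] := pselect (\forall n \near \oo, (f @` G) (u n)).
    by apply: filterS => n [z Gz <-]; exists z => //; exact: GU.
  by exfalso; apply: nbad; exists (G, u).
have {bad}[p pP] := choice bad.
have [x0 _ fx0] := fsurj y I.
have bdF x : boundary (f @^-1` [set y]) x -> f x = y.
  move=> [clx _]; have cF : closed (f @^-1` [set y]).
    apply: (closed_comp (fun x _ => fc x)).
    exact: (accessible_closed_set1 (hausdorff_accessible hY)).
  exact: cF.
have {}bdc := compact_cover_of_point x0 bdc.
have [||D DF Dcover] := bdc X (f @^-1` [set y]) (fun x => (p x).1).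
- by move=> x fx; case: (pP x fx).
- by move=> x /bdF fx; exists x => //; case: (pP x fx).
(* Adding [x0] keeps [s] nonempty even if [D] is empty, and its bad sequence prevents [z] from being
   eventually [y]. *)
pose s := x0 :: finmap.enum_fset D.
have sF x : x \in s -> f x = y.
  by rewrite inE => /predU1P[->//|/DF /set_mem].
pose z := interleave x0 s (fun x => (p x).2).
have zy : z @ \oo --> y by apply: cvg_interleave => // x /sF /pP[].
have [|x_ [l xl] fx] := fcov z; first by exists y.
have fxE : f \o x_ = z by apply/funext => n; exact: fx.
have [|x /= Dx pxl] := Dcover l.
  apply: lift_limit_in_boundary xl _ _ => //; first by rewrite fxE.
  (* Otherwise the sequence of [x0] would eventually equal [f x0], which lies in the image of
     [(p x0).1]. *)
  move=> zeq; have [_ px0 _] := pP x0 fx0; apply.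
  apply: (@near_interleave _ _ x0 s (fun x => (p x).2)); first exact: mem_head.
  by apply: filterS zeq => n e; exists x0 => //; rewrite fx0 -e fx.
have sx : x \in s by rewrite inE [x \in _]Dx orbT.
have [op _ _] := pP x (sF x sx); apply.
apply: (@near_interleave _ _ x0 s (fun x => (p x).2)) => //.
have : \forall n \near \oo, (p x).1 (x_ n).
  by apply: xl; exact: open_nbhs_nbhs.
by apply: filterS => n pn; exists (x_ n) => //; exact: fx.
Qed.

Theorem theorem3p6 (R : realType) (X Y : topologicalType) (f : X -> Y)
  (X_hausdorff : hausdorff_space X) (Y_hausdorff : hausdorff_space Y)
  (f_continuous : continuous f) (f_surj : set_surj [set: X] [set: Y] f)
  (f_seq_cov : sequence_covering f) (f_bd_compact : boundary_compact f)
  (X_Omega : Omega R X) :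
  one_sequence_covering f.
Proof.
move=> y.
have [x fx good] := exists_good_point Y_hausdorff f_continuous f_surj
  f_seq_cov (f_bd_compact y).
exists x => // u uy; apply: lift_cvg_of_image_nbhs => //.
  by have [] := X_Omega [set x] (@compact_set1 _ x).
exact: good.
Qed.
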